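(* Let $\mathcal{M}$ be a family of abelian groups and put $M=\prod\mathcal{M}$ (the direct product of all members of the family) and $S=\bigoplus\mathcal{M}$ (the direct sum of all members of the family). Then the following conditions are equivalent: (1) $M$ is self-small; (2) $M$ is $S$-small; (3) $M$ is $\bigoplus\mathcal{C}$-small for each countable subfamily $\mathcal{C}\subseteq\mathcal{M}$.
   Context: All groups are abelian. A family of groups may contain more than one copy of a group (i.e. it is an indexed family). For an abelian group $A$ and a class $\mathcal{C}$ of abelian groups, $A$ is called $\mathcal{C}$-small if for every family $(N_i)_{i\in I}$ ($I$ any set, repetitions allowed) of groups belonging to $\mathcal{C}$ the canonical injective homomorphism $\bigoplus_{i\in I}\mathrm{Hom}(A,N_i)\to\mathrm{Hom}(A,\bigoplus_{i\in I}N_i)$, $(f_i)_i\mapsto\sum_i f_i$, is an isomorphism. For an abelian group $B$, $A$ is called $B$-small if it is $\{B\}$-small, i.e. $\bigoplus_{i\in I}\mathrm{Hom}(A,B)\to\mathrm{Hom}(A,B^{(I)})$ is an isomorphism for every set $I$, where $B^{(I)}$ is the direct sum of $I$ copies of $B$. $A$ is self-small if it is $A$-small. *)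

(* Defs.v *)
From HB Require Import structures.
From mathcomp Require Import all_boot all_algebra.
From mathcomp Require Import boolp classical_sets functions cardinality.

Set Implicit Arguments.
Unset Strict Implicit.
Unset Printing Implicit Defensive.

Import GRing.Theory.
Local Open Scope classical_set_scope.
Local Open Scope ring_scope.

(* Abelian groups are zmodTypes; a family of groups is a function from an
   arbitrary index type, so that groups may be repeated. *)

Section DirectProduct.
Variables (I : Type) (N : I -> zmodType).

Definition dprod : Type := forall i, N i.

HB.instance Definition _ := Choice.copy dprod (forall i, N i).

Implicit Types f g h : dprod.

Definition dprod_zero : dprod := fun=> 0.
Definition dprod_opp f : dprod := fun i => - f i.
Definition dprod_add f g : dprod := fun i => f i + g i.

Fact dprod_addA : associative dprod_add.
Proof. by move=> f g h; apply: functional_extensionality_dep => i; exact: addrA. Qed.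
Fact dprod_addC : commutative dprod_add.
Proof. by move=> f g; apply: functional_extensionality_dep => i; exact: addrC. Qed.
Fact dprod_add0 : left_id dprod_zero dprod_add.
Proof. by move=> f; apply: functional_extensionality_dep => i; exact: add0r. Qed.
Fact dprod_addN : left_inverse dprod_zero dprod_opp dprod_add.
Proof. by move=> f; apply: functional_extensionality_dep => i; exact: addNr. Qed.

HB.instance Definition _ :=
  GRing.isZmodule.Build dprod dprod_addA dprod_addC dprod_add0 dprod_addN.

Lemma dprod0E i : (0 : dprod) i = 0. Proof. by []. Qed.
Lemma dprodNE f i : (- f) i = - f i. Proof. by []. Qed.
Lemma dprodDE f g i : (f + g) i = f i + g i. Proof. by []. Qed.
Lemma dprodBE f g i : (f - g) i = f i - g i. Proof. by []. Qed.

End DirectProduct.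

Identity Coercion fun_of_dprod : dprod >-> Funclass.

Section DirectSum.
Variables (I : Type) (N : I -> zmodType).

Definition fin_supp : {pred dprod N} :=
  fun f => `[< finite_set [set i | f i != 0] >].

Fact fin_supp_zmod_closed : zmod_closed fin_supp.
Proof.
split=> [|f g /asboolP ff /asboolP fg]; apply/asboolP.
  by apply: (sub_finite_set _ (@finite_set0 I)) => i /=; rewrite dprod0E eqxx.
have ffg : finite_set ([set i | f i != 0] `|` [set i | g i != 0]).
  by rewrite finite_setU.
apply: sub_finite_set ffg => i /=; rewrite dprodBE => fgi.
case: (eqVneq (f i) 0) => [fi0|]; [right|by left].
by apply: contraNneq fgi => gi0; rewrite fi0 gi0 subrr.
Qed.

HB.instance Definition _ :=
  GRing.isZmodClosed.Build (dprod N) fin_supp fin_supp_zmod_closed.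

Record dsum : Type :=
  DSum { dsum_val :> dprod N; dsum_valP : dsum_val \in fin_supp }.

HB.instance Definition _ := [isSub for dsum_val].
HB.instance Definition _ := [Choice of dsum by <:].
HB.instance Definition _ := [SubChoice_isSubZmodule of dsum by <:].

Lemma dsum_eqP (x y : dsum) : (forall i, x i = y i) <-> x = y.
Proof.
by split=> [xy|->//]; apply/val_inj/functional_extensionality_dep.
Qed.

Lemma finite_dsum_supp (x : dsum) : finite_set [set i | x i != 0].
Proof. exact/asboolP/(dsum_valP x). Qed.

End DirectSum.

Arguments fin_supp {I} N.

Section Hom.
Variables A B : zmodType.

HB.instance Definition _ := gen_eqMixin {additive A -> B}.
HB.instance Definition _ := gen_choiceMixin {additive A -> B}.

Implicit Types f g h : {additive A -> B}.

Lemma hom_eqP f g : f =1 g <-> f = g.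
Proof.
split=> [/funext|->//]; case: f g => [f [[cf]]] [g [[cg]]] /= fg.
by case: _ / fg cg => cg; rewrite (Prop_irrelevance cf cg).
Qed.

Definition hom_zero : {additive A -> B} := (\0)%R : A -> B.
Definition hom_opp f : {additive A -> B} := (\- f)%R.
Definition hom_add f g : {additive A -> B} := (f \+ g)%R.

Fact hom_addA : associative hom_add.
Proof. by move=> f g h; apply/hom_eqP => x; exact: addrA. Qed.
Fact hom_addC : commutative hom_add.
Proof. by move=> f g; apply/hom_eqP => x; exact: addrC. Qed.
Fact hom_add0 : left_id hom_zero hom_add.
Proof. by move=> f; apply/hom_eqP => x; exact: add0r. Qed.
Fact hom_addN : left_inverse hom_zero hom_opp hom_add.
Proof. by move=> f; apply/hom_eqP => x; exact: addNr. Qed.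

HB.instance Definition _ :=
  GRing.isZmodule.Build {additive A -> B} hom_addA hom_addC hom_add0 hom_addN.

Definition Hom : zmodType := [the zmodType of {additive A -> B}].

Lemma hom0E x : (0 : Hom) x = 0. Proof. by []. Qed.
Lemma homNE (f : Hom) x : (- f) x = - f x. Proof. by []. Qed.
Lemma homDE (f g : Hom) x : (f + g) x = f x + g x. Proof. by []. Qed.
Lemma homBE (f g : Hom) x : (f - g) x = f x - g x. Proof. by []. Qed.

End Hom.

Section CanonicalInjection.
Variables (I : Type) (N : I -> zmodType) (i : I).

Definition dsum_inj_val (x : N i) : dprod N := fun j =>
  if pselect (i = j) is left ij then ecast k (N k) ij x else 0.

Fact dsum_inj_subproof x : dsum_inj_val x \in fin_supp N.
Proof.
apply/asboolP/(sub_finite_set _ (finite_set1 i)) => j /=.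
by rewrite /dsum_inj_val; case: pselect => [ij|_]; [by move=> _|rewrite eqxx].
Qed.

Definition dsum_inj (x : N i) : dsum N := DSum (dsum_inj_subproof x).

Lemma dsum_inj_id x : dsum_inj x i = x.
Proof.
rewrite /= /dsum_inj_val; case: pselect => // ii.
by rewrite (Prop_irrelevance ii erefl).
Qed.

Lemma dsum_inj_neq x j : i <> j -> dsum_inj x j = 0.
Proof. by rewrite /= /dsum_inj_val; case: pselect. Qed.

Fact dsum_inj_zmod_morphism : zmod_morphism dsum_inj.
Proof.
move=> x y; apply/dsum_eqP => j /=; rewrite dprodBE /= /dsum_inj_val.
by case: pselect => [ij|_]; [case: _ / ij|rewrite subrr].
Qed.

HB.instance Definition _ :=
  GRing.isZmodMorphism.Build (N i) (dsum N) dsum_inj dsum_inj_zmod_morphism.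

End CanonicalInjection.

Section CanonicalMap.
Variables (A : zmodType) (I : Type) (N : I -> zmodType).

Let homs : Type := dsum (fun i => Hom A (N i)).

Fact sum_hom_subproof (f : homs) (a : A) :
  ((fun i => f i a) : dprod N) \in fin_supp N.
Proof.
apply/asboolP/(sub_finite_set _ (finite_dsum_supp f)) => i /=.
by apply: contraNneq => ->; rewrite hom0E.
Qed.

Definition sum_hom_fun (f : homs) (a : A) : dsum N :=
  DSum (sum_hom_subproof f a).

Fact sum_hom_fun_zmod_morphism f : zmod_morphism (sum_hom_fun f).
Proof.
by move=> a b; apply/dsum_eqP => i /=; rewrite dprodBE /= raddfB.
Qed.

HB.instance Definition _ f := GRing.isZmodMorphism.Build A (dsum N)
  (sum_hom_fun f) (sum_hom_fun_zmod_morphism f).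

(* The canonical map (f_i)_i |-> \sum_i f_i.  The i-th component of
   \sum_i f_i at a is f_i a; sum_hom is determined by its additivity and
   lemma sum_hom_inj below. *)
Definition sum_hom (f : homs) : Hom A (dsum N) := sum_hom_fun f.

Fact sum_hom_zmod_morphism : zmod_morphism sum_hom.
Proof.
move=> f g; apply/hom_eqP => a; rewrite homBE.
by apply/dsum_eqP => i.
Qed.

HB.instance Definition _ := GRing.isZmodMorphism.Build homs
  (Hom A (dsum N)) sum_hom sum_hom_zmod_morphism.

Lemma sum_homE f a i : sum_hom f a i = f i a. Proof. by []. Qed.

Lemma sum_hom_inj i (g : Hom A (N i)) :
  sum_hom (dsum_inj (N := fun i => Hom A (N i)) g) =
  (@dsum_inj _ N i \o g : Hom A (dsum N)).
Proof.
apply/hom_eqP => a; apply/dsum_eqP => j /=.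
by rewrite /dsum_inj_val; case: pselect => // ij; case: _ / ij.
Qed.

Lemma sum_hom_injective : injective sum_hom.
Proof.
move=> f g fg; apply/dsum_eqP => i; apply/hom_eqP => a.
by rewrite -!sum_homE fg.
Qed.

End CanonicalMap.

Arguments sum_hom A {I} N.

Definition class_small (A : zmodType) (C : zmodType -> Prop) : Prop :=
  forall (I : Type) (N : I -> zmodType), (forall i, C (N i)) ->
  bijective (sum_hom A N).

(* small A B: A is B-small, i.e. {B}-small; see smallP for the usual form. *)
Definition small (A B : zmodType) : Prop := class_small A (fun N => N = B).

Definition self_small (A : zmodType) : Prop := small A A.

Lemma smallP (A B : zmodType) :
  small A B <-> forall I : Type, bijective (sum_hom A (fun _ : I => B)).
Proof.
split=> [sAB I|sAB I N NB]; first exact: sAB.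
by have -> : N = fun=> B by exact: functional_extensionality_dep.
Qed.

Definition subfamily (I : Type) (M : I -> zmodType) (C : set I) :
  C -> zmodType := fun i => M (val i).

(* Main.v *)
Require Import Defs.
From HB Require Import structures.
From mathcomp Require Import all_boot all_algebra.
From mathcomp Require Import boolp classical_sets functions cardinality.

(** Everything rests on rephrasing smallness by sequences of homomorphisms.
    A homomorphism from A to a direct sum of copies of B is the same thing as
    a pointwise finite family of homomorphisms from A to B, meaning that each
    a in A is killed by all but finitely many of them; it lies in the image of
    the canonical map exactly when all but finitely many of them are zero.
    Passing to a countably infinite set of nonzero members, A is B-small iff
    no pointwise finite sequence of homomorphisms from A to B consists of
    nonzero terms only (lemma [small_seqP]).

    In this form smallness can be moved from one target to another one
    coordinate at a time.  Let g be a pointwise finite sequence of nonzero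
    homomorphisms from A to the product of groups N_i.  Each g_n has a nonzero
    coordinate, say the one of index i_n.  If all the groups N_(i_n) embed in a
    group B', following g_n by the projection to N_(i_n) and then by this
    embedding gives a pointwise finite sequence of nonzero homomorphisms to B',
    so that A is not B'-small (lemmas [small_coordinates] and [small_dprod]).

    Now (1) implies (2) because S embeds in M.  For (2) implies (3), the direct
    sum of a subfamily embeds in the product of the same subfamily, whose
    factors all embed in S.  For (3) implies (1), the groups M_(i_n) all embed
    in the direct sum of the subfamily indexed by the set of all i_n, which is
    countable: this is why countable subfamilies are enough. *)

Local Open Scope classical_set_scope.
Local Open Scope ring_scope.
Import GRing.Theory.
(* The algebra library also uses the name Hom, for linear maps. *)
Local Notation Hom := Defs.Hom.

Set Implicit Arguments.
Unset Strict Implicit.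

Section Coordinates.
Variables (I : Type) (N : I -> zmodType) (i : I).

Definition dprod_proj (x : dprod N) : N i := x i.

Fact dprod_proj_zmod_morphism : zmod_morphism dprod_proj.
Proof. by []. Qed.

HB.instance Definition _ := GRing.isZmodMorphism.Build (dprod N) (N i)
  dprod_proj dprod_proj_zmod_morphism.

Lemma dsum_inj_injective : injective (@dsum_inj I N i).
Proof. by move=> x y xy; rewrite -(dsum_inj_id x) xy dsum_inj_id. Qed.

End Coordinates.

Arguments dprod_proj {I N} i.

HB.instance Definition _ (I : Type) (N : I -> zmodType) :=
  GRing.isZmodMorphism.Build (dsum N) (dprod N) (@dsum_val I N)
    (fun x y => erefl).

Definition pointwise_finite (J : Type) (A B : zmodType) (g : J -> Hom A B) :=
  forall a, finite_set [set j | g j a != 0].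

Lemma hom_neq0P (A B : zmodType) (g : Hom A B) :
  g <> 0 -> exists a, g a <> 0.
Proof. by move=> g0; apply/existsNP => ga; apply/g0/hom_eqP. Qed.

(** A pointwise finite family is a homomorphism to the direct sum, and its
    preimage under the canonical map can only be the family itself. *)
Lemma small_finite_support (J : Type) (A B : zmodType) (g : J -> Hom A B) :
  small A B -> pointwise_finite g -> finite_set [set j | g j != 0].
Proof.
move=> /smallP/(_ J)[c _ cK] gfin.
pose G a : dsum (fun _ : J => B) :=
  DSum (introT (asboolP _) (gfin a) : (fun j => g j a) \in fin_supp _).
have Gadd : zmod_morphism G.
  by move=> a b; apply/dsum_eqP => j /=; rewrite dprodBE /= raddfB.
pose Gm := GRing.isZmodMorphism.Build _ _ G Gadd.
pose Gh : Hom A (dsum (fun _ : J => B)) := HB.pack_for {additive A -> _} G Gm.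
apply: sub_finite_set (finite_dsum_supp (c Gh)) => j /=.
apply: contra_neq => cj0; apply/hom_eqP => a.
by rewrite -[LHS]/(Gh a j) -[in LHS](cK Gh) sum_homE cj0.
Qed.

Lemma infinite_set_inj (T : Type) (D : set T) :
  infinite_set D -> exists2 e : nat -> T, forall n, D (e n) & injective e.
Proof.
move=> /infiniteP/card_leP[e].
pose in_nat n : [set: nat] := SigSub (in_setT n).
exists (fun n => val (e (in_nat n))) => [n|m n /val_inj emn].
  exact/set_mem/(valP (e (in_nat n))).
by have /(congr1 val) := 'inj_e (in_setT (in_nat m)) (in_setT (in_nat n)) emn.
Qed.

(** Sequences are enough to test smallness because infinitely many
    nonzero components of a homomorphism to a direct sum contain a sequence of
    components with distinct indices; the distinctness keeps this sequence
    pointwise finite. *)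
Lemma small_seqP (A B : zmodType) :
  small A B <->
  forall g : nat -> Hom A B, pointwise_finite g -> exists n, g n = 0.
Proof.
split=> [sAB g /(small_finite_support sAB) gfin | sAB].
  apply/not_existsP => g0; apply: infinite_nat; apply: sub_finite_set gfin.
  by move=> n _; exact/eqP.
apply/smallP => J; pose proj j : {additive dsum (fun _ : J => B) -> B} :=
  (dprod_proj j \o @dsum_val _ _).
pose comp (F : Hom A (dsum (fun _ : J => B))) j : Hom A B := proj j \o F.
have compfin F : comp F \in fin_supp (fun _ : J => Hom A B).
  apply/asboolP; apply: contrapT => /infinite_set_inj[e eF einj].
  have [a|n en0] := sAB (fun n => comp F (e n)).
    apply: (finite_preimage (f := e)) (finite_dsum_supp (F a)).
    by move=> m n _ _; exact: einj.
  by have := eF n; rewrite /= en0 eqxx.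
exists (fun F => DSum (compfin F)) => [f|F].
  by apply/dsum_eqP => j; apply/hom_eqP.
by apply/hom_eqP => a; apply/dsum_eqP.
Qed.

(** Smallness with respect to B' controls the sequences of homomorphisms to an
    unrelated group B, as far as they are seen through maps p n to groups that
    embed in B'.  Both the groups and the maps may vary with n. *)
Lemma small_coordinates (A B B' : zmodType) (P : nat -> zmodType)
    (p : forall n, {additive B -> P n}) (q : forall n, {additive P n -> B'})
    (g : nat -> Hom A B) :
  small A B' -> (forall n, injective (q n)) -> pointwise_finite g ->
  exists n, forall a, p n (g n a) = 0.
Proof.
move=> /small_seqP sAB' qinj gfin.
have [a|n n0] := sAB' (fun n => q n \o p n \o g n).
  apply: sub_finite_set (gfin a) => n /=.
  by apply: contra_neq => ->; rewrite !raddf0.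
exists n => a; apply: (qinj n); rewrite raddf0.
by move/hom_eqP: n0 => /(_ a).
Qed.

Lemma dprod_neq0P (I : Type) (N : I -> zmodType) (x : dprod N) :
  x <> 0 -> exists i, x i <> 0.
Proof.
by move=> x0; apply/existsNP => xi; apply/x0/functional_extensionality_dep.
Qed.

(** The embeddings e may depend on the sequence i of indices where the
    coordinates are nonzero, and so may the group B': this freedom allows B'
    to be built from countably many of the N i. *)
Lemma small_dprod (A : zmodType) (I : Type) (N : I -> zmodType) :
  (forall i : nat -> I, exists B' : zmodType, small A B' /\
     exists e : forall n, {additive N (i n) -> B'}, forall n, injective (e n)) ->
  small A (dprod N).
Proof.
move=> emb; apply/small_seqP => g gfin; apply/not_existsP => g0.
have /choice[i gi] n : exists i, exists a, g n a i <> 0.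
  by have [a /dprod_neq0P[i gai]] := hom_neq0P (g0 n); exists i, a.
have [B' [sAB' [e einj]]] := emb i.
pose p n : {additive dprod N -> N (i n)} := dprod_proj (i n).
have [n gn0] := small_coordinates p sAB' einj gfin.
by have [a] := gi n; apply; exact: gn0.
Qed.

(** The inclusion of the direct sum in the product is injective, so following
    a homomorphism by it never gives zero unless the homomorphism is zero. *)
Lemma small_dsum (A : zmodType) (I : Type) (N : I -> zmodType) :
  small A (dprod N) -> small A (dsum N).
Proof.
move=> sA; apply/small_seqP => g gfin.
pose p (n : nat) : {additive dsum N -> dprod N} := @dsum_val I N.
pose q (n : nat) : {additive dprod N -> dprod N} := idfun.
have [n gn0] := small_coordinates p (q := q) sA (fun _ _ _ => id) gfin.
exists n; apply/hom_eqP => a; exact/val_inj/gn0.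
Qed.

Unset Implicit Arguments.
Set Strict Implicit.

Theorem theorem3p1 (I : Type) (M : I -> zmodType) :
  [<-> self_small (dprod M);
       small (dprod M) (dsum M);
       forall C : set I, countable C ->
         small (dprod M) (dsum (@subfamily I M C))].
Proof.
split; first exact: small_dsum.
split=> [sS C _|sC].
  apply/small_dsum/small_dprod => i; exists (dsum M); split=> //.
  pose e n : {additive M (val (i n)) -> dsum M} := @dsum_inj I M (val (i n)).
  exists e => n; exact: dsum_inj_injective.
apply: small_dprod => i.
have iP n : i n \in range i by apply/mem_set; exists n.
pose N := subfamily M (C := range i); exists (dsum N); split.
  exact/sC/card_image_le.
pose j n : range i := SigSub (iP n).
pose e n : {additive N (j n) -> dsum N} := @dsum_inj _ N (j n).
by exists e => n; exact (@dsum_inj_injective _ N (j n)).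
Qed.
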